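(* Let $\Phi(v_1,\dots,v_n)=\frac{\kappa}{n}\sum_{i=1}^n v_i^n+h(v_1v_2\cdots v_n)$ and define the modified energy functional by $$\hat I(r):=\lim_{\varepsilon\to0^+}\left[\int_\varepsilon^1R^{n-1}\Phi(r(R))\,dR-\frac{\kappa(n-1)}{n}\,r(\varepsilon)^n\ln\left(\frac{r(\varepsilon)}{\varepsilon}\right)\right].$$ Assume that there are positive constants $K,\gamma_0$ such that $$|d\,h'(cd)|\le K[h(d)+1]\qquad\text{for all } d>0 \text{ and all } c \text{ with } |c-1|\le\gamma_0.$$ Let $r\in C^2((0,1])\cap C([0,1])$ be a solution of $$\frac{d}{dR}\left[R^{n-1}\Phi_{,1}(r(R))\right]=(n-1)R^{n-2}\Phi_{,2}(r(R)),\qquad 0<R<1,$$ and put $\lambda=r(1)$. Then: 1. If $r(0)>0$ and $\delta(R):=r'(R)\left(\frac{r(R)}{R}\right)^{n-1}$ is bounded, the modified energy $\hat I(r)$ is finite and given by $$\frac1n\left[\Phi(r(1))-r'(1)\Phi_{,1}(r(1))+\lambda^nT(r(1))\right]-\frac{\kappa(n-1)}{n^2}r(0)^n-\lim_{\varepsilon\to0^+}\left[T(r(\varepsilon))+\kappa(n-1)\ln\left(\frac{r(\varepsilon)}{\varepsilon}\right)\right]\frac{r^n(\varepsilon)}{n}.$$ 2. If $r(0)=0$, then $\hat I(r)=I(r)$ (possibly infinite), where $I(r)=\int_0^1R^{n-1}\Phi(r(R))\,dR$.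
   Context: $n\in\{2,3\}$ and $\kappa>0$. The function $h:(0,\infty)\to[0,\infty)$ is $C^1$ (with second derivative existing) and satisfies: $h''(d)>0$ for all $d>0$; $\lim_{d\to0^+}h(d)=\infty$; $\lim_{d\to\infty}h(d)/d=\infty$; $\lim_{d\to0^+}h'(d)=-\infty$; $\lim_{d\to\infty}h'(d)=\infty$. $\Phi_{,i}$ denotes the partial derivative of $\Phi$ with respect to its $i$-th argument; $\Phi(r(R))$ and $\Phi_{,i}(r(R))$ abbreviate $\Phi$ and $\Phi_{,i}$ evaluated at $\left(r'(R),\frac{r(R)}{R},\dots,\frac{r(R)}{R}\right)$. The radial Cauchy stress is $T(r(R))=\left[\frac{R}{r(R)}\right]^{n-1}\Phi_{,1}(r(R))$. All radial maps $r$ considered as solutions satisfy $r'(R)>0$ and $r(R)/R>0$ for $R\in(0,1]$. *)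

(* Defs.v *)
From HB Require Import structures.
From mathcomp Require Import all_boot all_order all_algebra.
From mathcomp Require Import all_classical all_reals all_analysis.

Set Implicit Arguments.
Unset Strict Implicit.
Unset Printing Implicit Defensive.

Import Order.TTheory GRing.Theory Num.Theory.
Import numFieldNormedType.Exports.

Local Open Scope ring_scope.
Local Open Scope classical_set_scope.

(* Differentiation relative to a set A, so that the derivative at an endpoint
   of an interval is the one-sided one.  At interior points of A this is the
   usual derivative. *)
Definition derivable1_within (R : realType) (A : set R) (f : R -> R) (x : R) :=
  cvg ((f y - f x) / (y - x) @[y --> within A x^']).

Definition derive1_within (R : realType) (A : set R) (f : R -> R) (x : R) : R :=
  lim ((f y - f x) / (y - x) @[y --> within A x^']).

Definition C2_on (R : realType) (A : set R) (f : R -> R) : Prop :=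
  [/\ forall x : R, A x -> derivable1_within A f x,
      forall x : R, A x -> derivable1_within A (derive1_within A f) x &
      {within A, continuous (derive1_within A (derive1_within A f))}].

(* The values of h outside (0, +oo) are irrelevant. *)
Record volumetric_energy (R : realType) (h : R -> R) : Prop := {
  vol_ge0 : forall d : R, 0 < d -> 0 <= h d;
  vol_derivable : forall d : R, 0 < d -> derivable h d 1;
  vol_C1 : forall d : R, 0 < d -> {for d, continuous h^`()};
  vol_derivable2 : forall d : R, 0 < d -> derivable h^`() d 1;
  vol_convex : forall d : R, 0 < d -> 0 < h^`()^`() d;
  vol_cvg0 : h d @[d --> 0^'+] --> +oo;
  vol_superlinear : h d / d @[d --> +oo] --> +oo;
  vol_derive_cvg0 : h^`() d @[d --> 0^'+] --> -oo;
  vol_derive_cvgy : h^`() d @[d --> +oo] --> +oo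
}.

(* Coordinates are numbered from 0: [partial F 0] is F_{,1} and
   [partial F 1] is F_{,2}. *)
Definition partial (R : realType) (n : nat) (F : 'rV[R]_n -> R) (i : nat)
    (v : 'rV[R]_n) : R :=
  'D_(\row_(j < n) (j == i :> nat)%:R) F v.

Section RadialElasticity.
Context {R : realType}.
Variables (n : nat) (kappa : R) (h : R -> R).

Definition Phi (v : 'rV[R]_n) : R :=
  kappa / n%:R * (\sum_(i < n) v 0 i ^+ n) + h (\prod_(i < n) v 0 i).

Variable r : R -> R.

Definition rprime : R -> R := derive1_within `]0, 1] r.

Definition stretches (x : R) : 'rV[R]_n :=
  \row_(j < n) if j == 0%N :> nat then rprime x else r x / x.

Definition Phi_r (x : R) : R := Phi (stretches x).

Definition dPhi_r (i : nat) (x : R) : R := partial Phi i (stretches x).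

Definition cauchy_stress (x : R) : R := (x / r x) ^+ n.-1 * dPhi_r 0 x.

Definition det_gradient (x : R) : R := rprime x * (r x / x) ^+ n.-1.

Definition radial_equilibrium : Prop :=
  forall x : R, 0 < x < 1 ->
    is_derive x 1 (fun y => y ^+ n.-1 * dPhi_r 0 y)
      (n.-1%:R * x ^+ n.-2 * dPhi_r 1 x).

Definition energy : \bar R :=
  \int[lebesgue_measure]_(x in `]0%R, 1%R]) (x ^+ n.-1 * Phi_r x)%:E.

Definition truncated_modified_energy (e : R) : \bar R :=
  (\int[lebesgue_measure]_(x in `[e, 1%R]) (x ^+ n.-1 * Phi_r x)%:E
   - (kappa * n.-1%:R / n%:R * r e ^+ n * ln (r e / e))%:E)%E.

Definition modified_energy : \bar R :=
  lim (truncated_modified_energy e @[e --> 0^'+]).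

End RadialElasticity.

(* Main.v *)
(* Write w = r / R, d = r' w^(n-1), P = R^(n-1) Phi_{,1} and n = m + 2.

   Along a solution, R^n Phi + (r - R r') P has derivative n R^(n-1) Phi (this
   needs the equation only through the derivative of P), so the truncated energy
   is a difference of boundary values.  The equation also reads
   T' = kappa (n-1) (1/R - R^(n-1) r'^n / r^n); when r(0) > 0 and d is bounded,
   r'/r is bounded and hence T + kappa (n-1) ln (r/R) is Lipschitz, so that it
   converges at 0.  Therefore T, and with it h'(d), grows at most like ln R, and
   convexity, h(d) <= h(1) + h'(d) (d - 1), gives R^n h(d) -> 0 and
   R^n d h'(d) -> 0.

   When r(0) = 0, split ln (r/e) = ln r - ln e.  The term r^n ln r vanishes in
   the limit and -ln e is the integral of 1/R over [e, 1], so what remains is the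
   integral over [e, 1] of R^(n-1) Phi - kappa (n-1)/n r(e)^n / R.  As r is
   increasing this integrand is nonnegative and increases as e decreases to 0;
   monotone convergence gives the limit. *)
Require Import Defs.
From HB Require Import structures.
From mathcomp Require Import all_boot all_order all_algebra.
From mathcomp Require Import all_classical all_reals all_analysis.
From mathcomp Require Import measurable_realfun ring lra.

Set Implicit Arguments.
Unset Strict Implicit.
Unset Printing Implicit Defensive.

Import Order.TTheory GRing.Theory Num.Theory.
Import numFieldNormedType.Exports.

Local Open Scope ring_scope.
Local Open Scope classical_set_scope.

(** * Differentiation relative to a set *)

Lemma derivable1_within_cvg (R : realType) (A : set R) (f : R -> R) (x : R) :
  derivable1_within A f x -> f y @[y --> within A (nbhs x)] --> f x.
Proof.
move=> df.
have H : f y @[y --> within A x^'] --> f x.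
  have yx : (y - x) @[y --> within A x^'] --> 0.
    rewrite -(subrr x); apply: cvgB; last exact: cvg_cst.
    have xx : y @[y --> within A x^'] --> x.
      by move=> P xP; rewrite !near_simpl !near_withinE; apply: (filterS _ xP).
    exact: xx.
  have H : (f x + (f y - f x) / (y - x) * (y - x)) @[y --> within A x^'] --> f x.
    rewrite -[X in _ --> X]addr0 -(mulr0 (derive1_within A f x)).
    by apply: cvgD; [exact: cvg_cst|exact: cvgM].
  apply: (cvg_trans _ H); apply: near_eq_cvg.
  rewrite !near_withinE; near=> y => yx' Ay /=.
  by rewrite divfK ?subr_eq0// addrC subrK.
apply/cvgrPdist_lt => e e0.
move/cvgrPdist_lt : H => /(_ e e0); rewrite !near_withinE.
apply: filterS => y Hy Ay; have [->|yx] := eqVneq y x; first by rewrite subrr normr0.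
exact: Hy.
Unshelve. all: by end_near. Qed.

(** At an interior point of [A] the punctured filters with and without [A] coincide, so the relative
    and the ordinary difference quotients have the same limit. *)
Lemma is_derive_derive1_within (R : realType) (A : set R) (f : R -> R) (x : R) :
  nbhs x A -> derivable1_within A f x -> is_derive x 1 f (derive1_within A f x).
Proof.
move=> nA df.
have E : within A x^' = x^'.
  apply/seteqP; split=> P H.
    have H' : \forall y \near x, y != x -> A y -> P y by exact: H.
    have nA' : \forall y \near x, A y by exact: nA.
    rewrite /dnbhs; change (\forall y \near x, y != x -> P y).
    by near=> y => yx; apply: (near H' y) => //; apply: (near nA' y).
  have H' : \forall y \near x, y != x -> P y by exact: H.
  change (\forall y \near x, y != x -> A y -> P y).
  by near=> y => yx _; exact: (near H' y).
apply/is_derive1_caratheodory.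
set l := derive1_within A f x.
(* Carathéodory's slope function: the difference quotient, completed at [x] by the relative
   derivative, which makes it continuous there. *)
exists (fun z => if z == x then l else (f z - f x) / (z - x)); split.
- move=> z; case: eqVneq => [->|zx]; first by rewrite !subrr mulr0.
  by rewrite divfK ?subr_eq0.
- apply/continuous_withinNx; rewrite eqxx /=.
  rewrite /l /derive1_within.
  have H : cvg ((f y - f x) / (y - x) @[y --> within A x^']) by [].
  rewrite E in H *; apply: (cvg_trans _ H); apply: near_eq_cvg.
  by rewrite near_withinE; near=> y => /negbTE ->.
- by rewrite eqxx.
Unshelve. all: by end_near. Qed.

(* The library instances are stated for the ring operations on functions and do
   not unify with explicit abstractions. *)
Section pointwise_is_derive.
Context {R : realType}.
Implicit Types (f g : R -> R) (x df dg k : R).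

Lemma is_derive1D f g x df dg : is_derive x 1 f df -> is_derive x 1 g dg ->
  is_derive x 1 (fun y => f y + g y) (df + dg).
Proof. exact: is_deriveD. Qed.

Lemma is_derive1B f g x df dg : is_derive x 1 f df -> is_derive x 1 g dg ->
  is_derive x 1 (fun y => f y - g y) (df - dg).
Proof. exact: is_deriveB. Qed.

Lemma is_derive1M f g x df dg : is_derive x 1 f df -> is_derive x 1 g dg ->
  is_derive x 1 (fun y => f y * g y) (df * g x + f x * dg).
Proof.
move=> f' g'; apply: (is_derive_eq (is_deriveM f' g')).
by rewrite addrC mulrC.
Qed.

Lemma is_derive1Z f k x df : is_derive x 1 f df ->
  is_derive x 1 (fun y => k * f y) (k * df).
Proof. exact: is_deriveZ. Qed.

Lemma is_derive1X f n x df : is_derive x 1 f df ->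
  is_derive x 1 (fun y => f y ^+ n) (n%:R * f x ^+ n.-1 * df).
Proof.
move=> f'; rewrite (_ : (fun y => f y ^+ n) = f ^+ n); last by rewrite exprfctE.
exact: is_deriveX.
Qed.

Lemma is_derive1V f x df : f x != 0 -> is_derive x 1 f df ->
  is_derive x 1 (fun y => (f y)^-1) (- (df / f x ^+ 2)).
Proof.
move=> fx0 f'; apply: (is_derive_eq (is_deriveV fx0 f')).
by rewrite [_ *: _]mulrC mulrN.
Qed.

End pointwise_is_derive.

(** * The stored energy and its partial derivatives *)

(** On the line through [u] in direction [i] only one power and one factor of the product vary, so
    [Phi] becomes a function [g] of one real variable and the usual chain rule applies. *)
Lemma partial_Phi (R : realType) (n : nat) (kappa : R) (h : R -> R)
    (u : 'rV[R]_n) (i : 'I_n) :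
  derivable h (\prod_(j < n) u 0 j) 1 ->
  partial (Phi kappa h) i u =
  kappa * u 0 i ^+ n.-1 + derive1 h (\prod_(j < n) u 0 j) * \prod_(j | j != i) u 0 j.
Proof.
move=> dh.
have n0 : n%:R != 0 :> R by rewrite pnatr_eq0; case: n i {u dh} => [[]|].
set e := (\row_(j < n) (j == i :> nat)%:R) : 'rV[R]_n.
pose g (t : R) := kappa / n%:R *
  ((t + u 0 i) ^+ n + \sum_(j | j != i) u 0 j ^+ n) +
  h ((t + u 0 i) * \prod_(j | j != i) u 0 j).
have gE t : Phi kappa h (t *: e + u) = g t.
  have eE j : (t *: e + u) 0 j = (if j == i then t else 0) + u 0 j.
    by rewrite !mxE (_ : (_ == _ :> nat) = (j == i))//; case: eqP => _;
      rewrite ?mulr1 ?mulr0.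
  rewrite /Phi /g (bigD1 i)//= [in h _](bigD1 i)//= !eE eqxx.
  congr (_ * (_ + _) + h (_ * _)); apply: eq_bigr => j /negbTE ji;
    by rewrite eE ji add0r.
have prodE : \prod_(j < n) u 0 j = (0 + u 0 i) * \prod_(j | j != i) u 0 j.
  by rewrite add0r (bigD1 i).
have dg : is_derive (0 : R) 1 g (kappa * u 0 i ^+ n.-1 +
    derive1 h (\prod_(j < n) u 0 j) * \prod_(j | j != i) u 0 j).
  have d1 : is_derive (0 : R) 1 (fun t => t + u 0 i) 1.
    exact: is_derive_shift.
  have d2 : is_derive (0 : R) 1
      (fun t => (t + u 0 i) * \prod_(j | j != i) u 0 j) (\prod_(j | j != i) u 0 j).
    apply: is_derive_eq.
    by rewrite scaler0 add0r [_ *: _]mulr1.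
  have d3 : is_derive (0 : R) 1
      (h \o (fun t => (t + u 0 i) * \prod_(j | j != i) u 0 j))
      (derive1 h (\prod_(j < n) u 0 j) * \prod_(j | j != i) u 0 j).
    apply: is_derive1_comp; rewrite -prodE derive1E; exact: derivableP.
  have d4 := is_derive1D (is_derive1X n d1)
    (is_derive_cst (\sum_(j | j != i) u 0 j ^+ n) (0 : R) 1).
  apply: (is_derive_eq (is_derive1D (is_derive1Z (kappa / n%:R) d4) d3)).
  by congr (_ + _); rewrite add0r addr0 mulr1 mulrA divfK.
(* The directional derivative of [Phi] and the derivative of [g] at 0 are limits of the same
   difference quotient. *)
rewrite /partial -/e -(@derive_val _ _ _ _ _ _ _ dg) /derive.
suff -> : (fun t => t^-1 *: ((Phi kappa h \o shift u) (t *: e) - Phi kappa h u)) =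
  (fun t => t^-1 *: ((g \o shift 0) (t%:A) - g 0)) by [].
apply/funext => t.
by rewrite /= -!gE addr0 [_%:A]mulr1 scale0r add0r.
Qed.

Section energy_density.
Variables (R : realType) (m : nat) (kappa : R) (h r : R -> R).
Hypothesis hh : volumetric_energy h.

Local Notation n := m.+2.
Local Notation v := (rprime r).
Local Notation d := (det_gradient n r).

Lemma prod_stretches x : \prod_(j < n) stretches n r x 0 j = d x.
Proof.
rewrite big_ord_recl !mxE /=; congr (_ * _).
under eq_bigr do rewrite mxE /=.
by rewrite prodr_const card_ord.
Qed.

Lemma Phi_rE x :
  Phi_r n kappa h r x =
  kappa / n%:R * (v x ^+ n + m.+1%:R * (r x / x) ^+ n) + h (d x).
Proof.
rewrite /Phi_r /Phi prod_stretches; congr (_ * _ + _).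
rewrite big_ord_recl !mxE /=; congr (_ + _).
under eq_bigr do rewrite mxE /=.
by rewrite sumr_const card_ord mulr_natl.
Qed.

Lemma dPhi_r0E x : 0 < d x ->
  dPhi_r n kappa h r 0 x =
  kappa * v x ^+ m.+1 + derive1 h (d x) * (r x / x) ^+ m.+1.
Proof.
move=> dx; rewrite /dPhi_r (@partial_Phi _ _ _ _ _ ord0); last first.
  by rewrite prod_stretches; exact: vol_derivable.
rewrite prod_stretches mxE /=; congr (_ + _ * _).
rewrite big_mkcond big_ord_recl /= mul1r.
under eq_bigr do rewrite mxE /=.
by rewrite prodr_const card_ord.
Qed.

Lemma dPhi_r1E x : 0 < d x ->
  dPhi_r n kappa h r 1 x =
  kappa * (r x / x) ^+ m.+1 + derive1 h (d x) * (v x * (r x / x) ^+ m).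
Proof.
move=> dx; rewrite /dPhi_r (@partial_Phi _ _ _ _ _ (lift ord0 ord0)); last first.
  by rewrite prod_stretches; exact: vol_derivable.
rewrite prod_stretches mxE /=; congr (_ + _ * _).
rewrite big_mkcond !big_ord_recl /= mul1r mxE /=; congr (_ * _).
under eq_bigr do rewrite mxE /=.
by rewrite prodr_const card_ord.
Qed.

End energy_density.

(** * Continuity, integration and monotonicity on (0, 1] *)

Section within_cvg.
Variables (R : realType).
Local Notation A := (`]0, 1]%classic : set R).

Lemma itv01_oo_oc (x : R) : 0 < x < 1 -> 0 < x <= 1.
Proof. by move=> /andP[-> /ltW]. Qed.

Lemma within_continuousP (f : R -> R) :
  {within A, continuous f} <->
  forall x : R, 0 < x <= 1 -> f y @[y --> within A (nbhs x)] --> f x.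
Proof.
split=> [/subspace_continuousP H x x01|H].
  by apply: H; rewrite /= in_itv.
by apply/subspace_continuousP => x; rewrite /= in_itv => /H.
Qed.

Lemma within_continuous_eq (f g : R -> R) :
  (forall x : R, 0 < x <= 1 -> f x = g x) ->
  {within A, continuous f} -> {within A, continuous g}.
Proof.
move=> fg; apply: subspace_eq_continuous => x; rewrite inE /= in_itv; exact: fg.
Qed.

Lemma cvg_within_id (x : R) : y @[y --> within A (nbhs x)] --> x.
Proof. by apply: cvg_within_filter; exact: cvg_id. Qed.

Lemma cvgrX (T : Type) (F : set_system T) (FF : Filter F) (f : T -> R) (l : R) k :
  f y @[y --> F] --> l -> (f y ^+ k) @[y --> F] --> l ^+ k.
Proof.
move=> fl; apply: (@continuous_cvg _ _ _ F FF f (fun y => y ^+ k)) => //.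
exact: exprn_continuous.
Qed.

(** Continuity up to 1 takes care of the right endpoint, where no two-sided derivative is given, and
    [0 < e] keeps the interval away from the singular point 0. *)
Lemma FTC2_oc (F f : R -> R) (e : R) : 0 < e < 1 ->
  {within A, continuous F} -> {within A, continuous f} ->
  (forall x : R, 0 < x < 1 -> is_derive x 1 F (f x)) ->
  (\int[lebesgue_measure]_(x in `[e, 1%R]) (f x)%:E = (F 1 - F e)%:E)%E.
Proof.
move=> /andP[e0 e1] cF cf dF.
have sub : `[e, 1] `<=` A by apply: subset_itvr; rewrite bnd_simp.
have cF' := continuous_subspaceW sub cF.
rewrite (@continuous_FTC2 _ f F)//.
- exact: continuous_subspaceW cf.
- have [_ ? ?] := (continuous_within_itvP F e1).1 cF'; split=> // x.
  rewrite in_itv /= => /andP[ex x1].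
  by apply: ex_derive; apply: dF; rewrite x1 (lt_trans e0).
- move=> x; rewrite in_itv /= => /andP[ex x1]; rewrite derive1E.
  by apply: derive_val; apply: dF; rewrite x1 (lt_trans e0).
Qed.

Lemma ndecr_oc (F f : R -> R) : {within A, continuous F} ->
  (forall x : R, 0 < x < 1 -> is_derive x 1 F (f x)) ->
  (forall x : R, 0 < x < 1 -> 0 <= f x) ->
  forall x y : R, 0 < x -> x <= y -> y <= 1 -> F x <= F y.
Proof.
move=> cF dF f0 x y x0 xy y1.
have sub : `[x, y] `<=` A by apply: subset_itv; rewrite bnd_simp.
have inxy z : z \in `]x, y[%R -> 0 < z < 1.
  rewrite in_itv /= => /andP[xz zy].
  by rewrite (lt_trans x0)//= (lt_le_trans zy).
apply: (@ger0_derive1_ndecr _ F x y) => //; last exact: continuous_subspaceW cF.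
- by move=> z /inxy z01; apply: ex_derive; exact: dF.
- by move=> z /inxy z01; rewrite derive1E (@derive_val _ _ _ _ _ _ _ (dF z z01)) f0.
Qed.

End within_cvg.

(** * Regularity of the stretches and of the energy density *)

Section regularity.
Variables (R : realType) (m : nat) (kappa : R) (h r : R -> R).

Local Notation n := m.+2.
Local Notation v := (rprime r).
Local Notation d := (det_gradient n r).
Local Notation A := (`]0, 1]%classic : set R).
Local Notation Phi1 := (dPhi_r n kappa h r 0).

Hypothesis hh : volumetric_energy h.
Hypothesis rC2 : C2_on A r.
Hypothesis v_gt0 : forall x : R, 0 < x <= 1 -> 0 < v x.
Hypothesis w_gt0 : forall x : R, 0 < x <= 1 -> 0 < r x / x.

Lemma r_gt0 (x : R) : 0 < x <= 1 -> 0 < r x.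
Proof.
move=> x01; have := w_gt0 x01; rewrite pmulr_lgt0 //.
by rewrite invr_gt0; case/andP: x01.
Qed.

Lemma det_gradient_gt0 (x : R) : 0 < x <= 1 -> 0 < d x.
Proof. by move=> x01; rewrite mulr_gt0 ?v_gt0// exprn_gt0// w_gt0. Qed.

Lemma nbhs_oc (x : R) : 0 < x < 1 -> nbhs x A.
Proof.
move=> x01; apply: (filterS (P := `]0, 1[%classic)).
  by move=> y /=; rewrite !in_itv/= => /andP[-> /ltW].
by apply: near_in_itvoo; rewrite in_itv.
Qed.

Lemma is_derive_r (x : R) : 0 < x < 1 -> is_derive x 1 r (v x).
Proof.
move=> x01; apply: is_derive_derive1_within; first exact: nbhs_oc.
case: rC2 => + _ _; apply; rewrite /= in_itv/=.
by case/andP: x01 => -> /ltW.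
Qed.

Lemma is_derive_rprime (x : R) : 0 < x < 1 ->
  is_derive x 1 v (derive1_within A v x).
Proof.
move=> x01; apply: is_derive_derive1_within; first exact: nbhs_oc.
case: rC2 => _ + _; apply; rewrite /= in_itv/=.
by case/andP: x01 => -> /ltW.
Qed.

Lemma cvg_within_r (x : R) : 0 < x <= 1 -> r y @[y --> within A (nbhs x)] --> r x.
Proof.
move=> x01; apply: derivable1_within_cvg.
by case: rC2 => + _ _; apply; rewrite /= in_itv.
Qed.

Lemma cvg_within_rprime (x : R) : 0 < x <= 1 ->
  v y @[y --> within A (nbhs x)] --> v x.
Proof.
move=> x01; apply: derivable1_within_cvg.
by case: rC2 => _ + _; apply; rewrite /= in_itv.
Qed.

Lemma cvg_within_hoop (x : R) : 0 < x <= 1 ->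
  (r y / y) @[y --> within A (nbhs x)] --> r x / x.
Proof.
move=> x01; apply: cvgM; first exact: cvg_within_r.
by apply: cvgV; [case/andP: x01 => /lt0r_neq0|exact: cvg_within_id].
Qed.

Lemma cvg_within_det (x : R) : 0 < x <= 1 ->
  d y @[y --> within A (nbhs x)] --> d x.
Proof.
move=> x01; apply: cvgM; first exact: cvg_within_rprime.
exact: (cvgrX _ (cvg_within_hoop x01)).
Qed.

Lemma within_continuous_Phi : {within A, continuous (Phi_r n kappa h r)}.
Proof.
apply: (within_continuous_eq (f := fun x =>
  kappa / n%:R * (v x ^+ n + m.+1%:R * (r x / x) ^+ n) + h (d x))).
  by move=> x _; rewrite Phi_rE.
apply/within_continuousP => x x01.
apply: cvgD.
  apply: cvgM; first exact: cvg_cst.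
  apply: cvgD; first exact: (cvgrX _ (cvg_within_rprime x01)).
  apply: cvgM; first exact: cvg_cst.
  exact: (cvgrX _ (cvg_within_hoop x01)).
apply: (continuous_cvg _ _ (cvg_within_det x01)).
apply/differentiable_continuous/derivable1_diffP.
by apply: (vol_derivable hh); exact: det_gradient_gt0.
Qed.

Lemma within_continuous_dPhi : {within A, continuous Phi1}.
Proof.
apply: (within_continuous_eq (f := fun x =>
  kappa * v x ^+ m.+1 + derive1 h (d x) * (r x / x) ^+ m.+1)).
  by move=> x x01; rewrite dPhi_r0E//; exact: det_gradient_gt0.
apply/within_continuousP => x x01.
apply: cvgD.
  apply: cvgM; first exact: cvg_cst.
  exact: (cvgrX _ (cvg_within_rprime x01)).
apply: cvgM; last exact: (cvgrX _ (cvg_within_hoop x01)).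
apply: (continuous_cvg _ _ (cvg_within_det x01)).
by apply: (vol_C1 hh); exact: det_gradient_gt0.
Qed.

End regularity.

(** * Identities along an equilibrium solution *)

Section equilibrium_identities.
Variables (R : realType) (m : nat) (kappa : R) (h r : R -> R).

Local Notation n := m.+2.
Local Notation v := (rprime r).
Local Notation d := (det_gradient n r).
Local Notation A := (`]0, 1]%classic : set R).
Local Notation Phi1 := (dPhi_r n kappa h r 0).

Hypothesis hh : volumetric_energy h.
Hypothesis rC2 : C2_on A r.
Hypothesis v_gt0 : forall x : R, 0 < x <= 1 -> 0 < v x.
Hypothesis w_gt0 : forall x : R, 0 < x <= 1 -> 0 < r x / x.
Hypothesis hsol : radial_equilibrium n kappa h r.

(* [(r x - x * v x) * x ^+ n.-1 * Phi1 x] is the paper's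
   [- x ^+ n * v x * Phi1 x + r x ^+ n * T x]. *)
Definition energy_primitive (x : R) : R :=
  n%:R^-1 * (x ^+ n * Phi_r n kappa h r x + (r x - x * v x) * (x ^+ n.-1 * Phi1 x)).

(** The derivative of [ln (r x / x)] is [v x / r x - 1 / x]; its second part cancels the [1 / x]
    singularity in the derivative of the Cauchy stress. *)
Definition log_corrected_stress (x : R) : R :=
  cauchy_stress n kappa h r x + kappa * n.-1%:R * ln (r x / x).

Lemma is_derive_hoop (x : R) : 0 < x < 1 ->
  is_derive x 1 (fun y => r y / y) ((v x - r x / x) / x).
Proof.
move=> x01; have x0 : x != 0 by case/andP: x01 => /lt0r_neq0.
have dr := is_derive_r rC2 x01.
apply: (is_derive_eq (is_derive1M dr (is_derive1V x0 (is_derive_id x 1)))).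
by field.
Qed.

(** The two terms in r'' cancel, and so do the two in Phi_{,2}: one comes from differentiating the
    hoop stretches in Phi, the other from the equilibrium equation. *)
Lemma is_derive_energy_primitive (x : R) : 0 < x < 1 ->
  is_derive x 1 energy_primitive (x ^+ n.-1 * Phi_r n kappa h r x).
Proof.
move=> x01; have x0 : x != 0 by case/andP: x01 => /lt0r_neq0.
have dr := is_derive_r rC2 x01.
have dv := is_derive_rprime rC2 x01.
have dw := is_derive_hoop x01.
have did := is_derive_id x (1 : R).
have d0 : 0 < d x by apply: det_gradient_gt0 => //; exact: itv01_oo_oc.
have dd := is_derive1M dv (is_derive1X m.+1 dw).
have dh : is_derive (d x) 1 h (derive1 h (d x)).
  by rewrite derive1E; apply: derivableP; exact: (vol_derivable hh).
have dPhi := is_derive1D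
  (is_derive1Z (kappa / n%:R) (is_derive1D (is_derive1X n dv)
    (is_derive1Z m.+1%:R (is_derive1X n dw))))
  (is_derive1_comp dh dd).
have PhiE : Phi_r n kappa h r = (fun y => kappa / n%:R *
    (v y ^+ n + m.+1%:R * (r y / y) ^+ n) + h (v y * (r y / y) ^+ m.+1)).
  by apply/funext => y; rewrite Phi_rE.
rewrite -[X in is_derive _ _ X _]PhiE in dPhi.
have dP := hsol x01.
apply: (is_derive_eq (is_derive1Z n%:R^-1 (is_derive1D
  (is_derive1M (is_derive1X n did) dPhi)
  (is_derive1M (is_derive1B dr (is_derive1M did dv)) dP)))).
rewrite Phi_rE dPhi_r0E// dPhi_r1E//=.
(* With [r x] written as hoop stretch times [x], and h, h', r'' and the m-th powers as independent
   variables, a rational identity is left. *)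
move: (derive1 h (d x)) (h (d x)) (derive1_within A v x) => h1 h0 a.
rewrite (_ : r x = r x / x * x); last by rewrite divfK.
rewrite mulfK//.
move: (r x / x) (v x) => w vx.
have m2 : m.+2%:R != 0 :> R by rewrite pnatr_eq0.
move: m2; rewrite -!natr1 !exprS => m2.
move: (vx ^+ m) (w ^+ m) (x ^+ m) => V W X.
field.
by rewrite m2 x0.
Qed.

(** The contributions of h' through Phi_{,1} and Phi_{,2} cancel, so the derivative involves only
    [x], [r] and [v]. *)
Lemma is_derive_log_corrected_stress (x : R) : 0 < x < 1 ->
  is_derive x 1 log_corrected_stress
    (kappa * m.+1%:R * (v x / r x - x ^+ m.+1 * v x ^+ n / r x ^+ n)).
Proof.
move=> x01; have x0 : x != 0 by case/andP: x01 => /lt0r_neq0.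
have rx0 := r_gt0 w_gt0 (itv01_oo_oc x01).
have dr := is_derive_r rC2 x01.
have dw := is_derive_hoop x01.
have d0 : 0 < d x by apply: det_gradient_gt0 => //; exact: itv01_oo_oc.
have dln := is_derive1_comp (g := fun y => r y / y)
  (is_derive1_ln (w_gt0 (itv01_oo_oc x01))) dw.
have rn0 : r x ^+ m.+1 != 0 by rewrite expf_neq0// gt_eqF.
(* The stress is rewritten through [y ^+ m.+1 * Phi1 y], whose derivative the equilibrium equation
   supplies. *)
have SE : log_corrected_stress = (fun y =>
    y ^+ m.+1 * Phi1 y * (r y ^+ m.+1)^-1 + kappa * m.+1%:R * ln (r y / y)).
  apply/funext => y; rewrite /log_corrected_stress /cauchy_stress expr_div_n.
  by rewrite mulrAC.
have D := is_derive1D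
  (is_derive1M (hsol x01)
    (is_derive1V (f := fun y => r y ^+ m.+1) rn0 (is_derive1X m.+1 dr)))
  (is_derive1Z (kappa * m.+1%:R) dln).
rewrite SE.
apply: (is_derive_eq D).
rewrite dPhi_r0E// dPhi_r1E//=.
move: (derive1 h (d x)) => h1.
have rE : r x = r x / x * x by rewrite divfK.
have w0 := w_gt0 (itv01_oo_oc x01).
rewrite rE mulfK//.
move: w0; move: (r x / x) (v x) => w vx /lt0r_neq0 w0.
have W0 : w ^+ m != 0 by rewrite expf_neq0.
have X0 : x ^+ m != 0 by rewrite expf_neq0.
rewrite -!natr1 !exprMn !exprS.
move: W0 X0; move: (vx ^+ m) (w ^+ m) (x ^+ m) => V W X W0 X0.
by field; rewrite w0 W0 x0 X0.
Qed.

Lemma within_continuous_energy_primitive : {within A, continuous energy_primitive}.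
Proof.
apply/within_continuousP => x x01.
have cPhi := (within_continuousP _).1 (within_continuous_Phi hh rC2 v_gt0 w_gt0) x x01.
have cdPhi := (within_continuousP _).1 (within_continuous_dPhi hh rC2 v_gt0 w_gt0) x x01.
have cid := @cvg_within_id R x.
apply: cvgM; first exact: cvg_cst.
apply: cvgD; first by apply: cvgM => //; exact: cvgrX.
apply: cvgM; last by apply: cvgM => //; exact: cvgrX.
apply: cvgB; first exact: cvg_within_r.
by apply: cvgM => //; exact: cvg_within_rprime.
Qed.

Lemma within_continuous_energy_density :
  {within A, continuous (fun x => x ^+ n.-1 * Phi_r n kappa h r x)}.
Proof.
apply/within_continuousP => x x01.
apply: cvgM; first exact: cvgrX (@cvg_within_id R x).
exact: ((within_continuousP _).1 (within_continuous_Phi hh rC2 v_gt0 w_gt0)).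
Qed.

Lemma within_continuous_log_corrected_stress :
  {within A, continuous log_corrected_stress}.
Proof.
apply/within_continuousP => x x01.
have cdPhi := (within_continuousP _).1 (within_continuous_dPhi hh rC2 v_gt0 w_gt0) x x01.
apply: cvgD.
  apply: cvgM => //; apply: cvgrX; apply: cvgM; first exact: cvg_within_id.
  by apply: cvgV; [rewrite gt_eqF//; exact: r_gt0|exact: cvg_within_r].
apply: cvgM; first exact: cvg_cst.
apply: (continuous_cvg _ _ (cvg_within_hoop rC2 x01)).
exact: continuous_ln (w_gt0 x01).
Qed.

Lemma r_le (x y : R) : 0 < x -> x <= y -> y <= 1 -> r x <= r y.
Proof.
apply: (ndecr_oc (f := v)).
- by apply/within_continuousP => z; exact: cvg_within_r.
- by move=> z; exact: is_derive_r.
- by move=> z z01; apply/ltW/v_gt0/itv01_oo_oc.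
Qed.

Lemma integral_energy_density (e : R) : 0 < e < 1 ->
  (\int[lebesgue_measure]_(x in `[e, 1%R]) (x ^+ n.-1 * Phi_r n kappa h r x)%:E
   = (energy_primitive 1 - energy_primitive e)%:E)%E.
Proof.
move=> e01; apply: (FTC2_oc e01 (F := energy_primitive)).
- exact: within_continuous_energy_primitive.
- exact: within_continuous_energy_density.
- by move=> x; exact: is_derive_energy_primitive.
Qed.

End equilibrium_identities.

(** * Limits at zero, and convexity of h *)

Section limits_at_zero.
Variable R : realType.
Local Notation A := (`]0, 1]%classic : set R).

Lemma cvg0_le (T : Type) (F : set_system T) {FF : Filter F} (f g : T -> R) :
  (\forall x \near F, `|f x| <= g x) -> g x @[x --> F] --> (0 : R) ->
  f x @[x --> F] --> (0 : R).
Proof.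
move=> fg g0; apply: norm_cvg0.
apply: (squeeze_cvgr (f := cst 0) _ _ g0); last exact: cvg_cst.
by apply: filterS fg => x ->; rewrite normr_ge0.
Qed.

Lemma cvg0M_bounded (T : Type) (F : set_system T) {FF : Filter F} (f g : T -> R) M :
  (\forall x \near F, `|f x| <= M) -> g x @[x --> F] --> (0 : R) ->
  (f x * g x) @[x --> F] --> (0 : R).
Proof.
move=> fM g0; apply: (cvg0_le (g := fun x => M * `|g x|)).
  by apply: filterS fM => x fM; rewrite normrM ler_wpM2r.
rewrite -(mulr0 M) -[X in _ * X](@normr0 _ R); apply: cvgM; first exact: cvg_cst.
exact: cvg_norm.
Qed.

Lemma near_at_right01 : \forall x \near (0 : R)^'+, 0 < x < 1.
Proof.
near=> x; apply/andP; split; near: x; first exact: nbhs_right_gt.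
exact: nbhs_right_lt.
Unshelve. all: by end_near. Qed.

Lemma cvg_at_right0_id : x @[x --> (0 : R)^'+] --> (0 : R).
Proof. by apply: cvg_within_filter; exact: cvg_id. Qed.

(** Since [ln x^-1 <= x^-1], the logarithm costs one power of [x]; the others are at most 1 except
    for one that is kept. *)
Lemma normr_exprM_ln_le (m : nat) (x : R) : 0 < x <= 1 ->
  `|x ^+ m.+2 * ln x| <= x.
Proof.
move=> /andP[x0 x1].
have ln0 : ln x <= 0 by exact: ln_le0.
rewrite normrM ger0_norm ?exprn_ge0 ?(ltW x0)// ler0_norm// -lnV ?posrE//.
have lnx : ln x^-1 <= x^-1 by rewrite ltW// ln_sublinear ?invr_gt0.
apply: (@le_trans _ _ (x ^+ m.+2 * x^-1)).
  by rewrite ler_wpM2l// exprn_ge0// ltW.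
rewrite exprSr mulfK ?gt_eqF// exprS ler_piMr ?(ltW x0)//.
by rewrite exprn_ile1// ltW.
Qed.

Lemma cvg_at_right0_exprM_ln (m : nat) (f : R -> R) :
  (\forall x \near 0^'+, 0 < f x) -> f x @[x --> 0^'+] --> (0 : R) ->
  (f x ^+ m.+2 * ln (f x)) @[x --> 0^'+] --> (0 : R).
Proof.
move=> f0 fl; apply: (cvg0_le _ fl).
have f1 : \forall x \near 0^'+, f x <= 1 by apply: (cvgr_le _ fl); exact: ltr01.
by apply: filterS2 f0 f1 => x f0 f1; apply: normr_exprM_ln_le; rewrite f0.
Qed.

(** Both [F x + B * x] and [B * x - F x] are nondecreasing: the first is monotone, the second bounds
    it from below, so the first has a finite limit. *)
Lemma is_cvg_at_right0_bounded_derive (F f : R -> R) (B : R) :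
  {within A, continuous F} ->
  (forall x : R, 0 < x < 1 -> is_derive x 1 F (f x)) ->
  (forall x : R, 0 < x < 1 -> `|f x| <= B) ->
  cvg (F x @[x --> 0^'+]).
Proof.
move=> cF dF fB.
have cBx : {within A, continuous (fun x => B * x)}.
  apply/within_continuousP => x _; apply: cvgM; first exact: cvg_cst.
  exact: cvg_within_id.
have dBx (x : R) := is_derive1Z B (is_derive_id x 1).
have up : forall x y : R, 0 < x -> x <= y -> y <= 1 -> F x + B * x <= F y + B * y.
  apply: (ndecr_oc (F := fun x => F x + B * x) (f := fun x => f x + B * 1)).
  - apply/within_continuousP => x x01; apply: cvgD;
      exact: ((within_continuousP _).1).
  - by move=> x x01; apply: is_derive1D => //; exact: dF.
  - by move=> x /fB; rewrite mulr1 ler_norml => /andP[+ _]; rewrite -subr_ge0 opprK.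
have dn : forall x y : R, 0 < x -> x <= y -> y <= 1 -> B * x - F x <= B * y - F y.
  apply: (ndecr_oc (F := fun x => B * x - F x) (f := fun x => B * 1 - f x)).
  - apply/within_continuousP => x x01; apply: cvgB;
      exact: ((within_continuousP _).1).
  - by move=> x x01; apply: is_derive1B => //; exact: dF.
  - by move=> x /fB; rewrite mulr1 ler_norml => /andP[_]; rewrite subr_ge0.
have c : cvg ((F x + B * x) @[x --> 0^'+]).
  apply/cvg_ex; eexists.
  apply: (@nondecreasing_at_right_cvgr _ _ _ (BLeft 1)).
  - by rewrite bnd_simp ltr01.
  - move=> x y; rewrite !in_itv/= => /andP[x0 _] /andP[_ y1] xy.
    by apply: up => //; exact: ltW.
  - exists (F 1 - B) => _ [x /= + <-]; rewrite in_itv/= => /andP[x0 x1].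
    have B0 : 0 <= B.
      by apply: le_trans (normr_ge0 _) (fB x _); rewrite x0.
    have := dn x 1 x0 (ltW x1) (lexx 1); have : 0 <= B * x by rewrite mulr_ge0// ltW.
    by rewrite mulr1; lra.
have E : F = (fun x => F x + B * x - B * x) by apply/funext => x; rewrite addrK.
rewrite E; apply: is_cvgB => //; apply: is_cvgM; first exact: is_cvg_cst.
by apply/cvg_ex; exists 0; exact: cvg_at_right0_id.
Qed.

End limits_at_zero.

(** The sign of h'' makes h' nondecreasing; the mean value theorem then compares the chord slope
    with the slope at [a], on either side of [a]. *)
Lemma volumetric_energy_tangent (R : realType) (h : R -> R) (a b : R) :
  volumetric_energy h -> 0 < a -> 0 < b ->
  h a + derive1 h a * (b - a) <= h b.
Proof.
move=> hh a0 b0.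
have dh (x : R) : 0 < x -> is_derive x 1 h (derive1 h x).
  by move=> x0; rewrite derive1E; apply: derivableP; exact: (vol_derivable hh).
have ch (x y : R) : 0 < x -> {within `[x, y], continuous h}.
  move=> x0; apply: derivable_within_continuous => z.
  rewrite in_itv/= => /andP[xz _]; apply: (vol_derivable hh).
  exact: lt_le_trans xz.
have h'nd (x y : R) : 0 < x -> x <= y -> derive1 h x <= derive1 h y.
  move=> x0 xy; apply: (@ger0_derive1_ndecr _ (derive1 h) x y) => //.
  - move=> z; rewrite in_itv/= => /andP[xz _]; apply: (vol_derivable2 hh).
    exact: lt_trans xz.
  - move=> z; rewrite in_itv/= => /andP[xz _]; apply/ltW/(vol_convex hh).
    exact: lt_trans xz.
  - apply: derivable_within_continuous => z; rewrite in_itv/= => /andP[xz _].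
    by apply: (vol_derivable2 hh); exact: lt_le_trans xz.
have [ab|ba] := leP a b.
  have [z zab] : exists2 z, z \in `[a, b]%R & h b - h a = derive1 h z * (b - a).
    apply: MVT_segment => //; last exact: ch.
    by move=> z; rewrite in_itv/= => /andP[az _]; apply: dh; exact: lt_trans az.
  move: zab; rewrite in_itv/= => /andP[az zb] hE.
  have : derive1 h a * (b - a) <= derive1 h z * (b - a).
    by rewrite ler_wpM2r ?subr_ge0// h'nd.
  by rewrite -hE; lra.
have [z zab] : exists2 z, z \in `[b, a]%R & h a - h b = derive1 h z * (a - b).
  apply: MVT_segment; [exact: ltW| |exact: ch].
  by move=> z; rewrite in_itv/= => /andP[az _]; apply: dh; exact: lt_trans az.
move: zab; rewrite in_itv/= => /andP[bz za] hE.
have : derive1 h z * (a - b) <= derive1 h a * (a - b).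
  apply: ler_wpM2r; first by rewrite subr_ge0 ltW.
  by apply: h'nd => //; exact: lt_le_trans bz.
by rewrite -hE -(opprB a b) mulrN; lra.
Qed.

(** * The case r(0) > 0 *)

Section cavitating.
Variables (R : realType) (m : nat) (kappa : R) (h r : R -> R).

Local Notation n := m.+2.
Local Notation v := (rprime r).
Local Notation d := (det_gradient n r).
Local Notation A := (`]0, 1]%classic : set R).
Local Notation Phi1 := (dPhi_r n kappa h r 0).
Local Notation S := (log_corrected_stress m kappa h r).

Hypothesis kappa0 : 0 < kappa.
Hypothesis hh : volumetric_energy h.
Hypothesis rC2 : C2_on A r.
Hypothesis v_gt0 : forall x : R, 0 < x <= 1 -> 0 < v x.
Hypothesis w_gt0 : forall x : R, 0 < x <= 1 -> 0 < r x / x.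
Hypothesis hsol : radial_equilibrium n kappa h r.
Hypothesis r_cvg0 : r x @[x --> 0^'+] --> r 0.
Hypothesis r0_gt0 : 0 < r 0.
Variable M : R.
Hypothesis dM : forall x : R, 0 < x <= 1 -> d x <= M.

Let M_ge0 : 0 <= M.
Proof.
have h1 : 0 < (1 : R) <= 1 by rewrite ltr01 lexx.
by apply: le_trans (dM h1); exact/ltW/det_gradient_gt0.
Qed.

Lemma r0_le (x : R) : 0 < x <= 1 -> r 0 <= r x.
Proof.
move=> /andP[x0 x1]; apply: (cvgr_to_le r_cvg0).
have lex : \forall y \near (0 : R)^'+, y <= x by exact: nbhs_right_ltW.
apply: filterS2 lex (@near_at_right01 R) => y yx /andP[y0 _].
exact: (r_le rC2 v_gt0).
Qed.

Let Q : R := M / r 0 ^+ n.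

Let Q_ge0 : 0 <= Q. Proof. by rewrite divr_ge0// exprn_ge0// ltW. Qed.

(** The quotient equals [d x * x ^+ m.+1 / r x ^+ n], where [d x <= M], [x <= 1] and
    [r 0 <= r x]. *)
Lemma rprime_div_r_le (x : R) : 0 < x <= 1 -> 0 <= v x / r x <= Q.
Proof.
move=> x01; have rx0 := r_gt0 w_gt0 x01; have vx0 := v_gt0 x01.
have [x0 x1] := andP x01.
rewrite divr_ge0 ?(ltW vx0) ?(ltW rx0)//=.
have -> : v x / r x = d x * x ^+ m.+1 / r x ^+ n.
  rewrite /det_gradient expr_div_n (exprSr (r x) m.+1) /=; field.
  by rewrite !gt_eqF// exprn_gt0.
rewrite /Q; apply: ler_pM.
- by rewrite mulr_ge0 ?exprn_ge0 ?(ltW x0)// ltW// det_gradient_gt0.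
- by rewrite invr_ge0 exprn_ge0// ltW.
- rewrite -[M]mulr1; apply: ler_pM => //; last 2 first.
  + exact: dM.
  + by rewrite exprn_ile1// ltW.
  + by rewrite ltW// det_gradient_gt0.
  + by rewrite exprn_ge0// ltW.
- by rewrite lef_pV2 ?posrE ?exprn_gt0// lerXn2r ?nnegrE ?(ltW rx0) ?(ltW r0_gt0)// r0_le.
Qed.

(** With q = r'/r the derivative of [S] is [kappa * m.+1%:R] times [q - x ^+ m.+1 * q ^+ n], bounded
    because [0 <= q <= Q]. *)
Lemma is_cvg_log_corrected_stress : cvg (S x @[x --> 0^'+]).
Proof.
have k1 : 0 <= kappa * m.+1%:R by rewrite mulr_ge0// ltW.
apply: (@is_cvg_at_right0_bounded_derive _ S (fun x => kappa * m.+1%:R *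
    (v x / r x - x ^+ m.+1 * v x ^+ n / r x ^+ n)) (kappa * m.+1%:R * (Q + Q ^+ n))).
- exact: within_continuous_log_corrected_stress.
- by move=> x x01; exact: (is_derive_log_corrected_stress hh rC2 v_gt0 w_gt0 hsol).
move=> x /itv01_oo_oc x01; have [x0 x1] := andP x01.
have /andP[q0 q1] := rprime_div_r_le x01.
rewrite normrM ger0_norm// ler_wpM2l//.
rewrite -mulrA -expr_div_n; apply: le_trans (ler_normB _ _) _.
have q0n : 0 <= (v x / r x) ^+ n by rewrite exprn_ge0.
rewrite !ger0_norm//; last by rewrite mulr_ge0// exprn_ge0// ltW.
apply: lerD => //; apply: (@le_trans _ _ ((v x / r x) ^+ n)).
  by rewrite ler_piMl// exprn_ile1// ltW.
by rewrite lerXn2r// nnegrE.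
Qed.

Let cvg_exprn0 k : (x ^+ k.+1) @[x --> (0 : R)^'+] --> (0 : R).
Proof.
rewrite -[X in _ --> X](expr0n _ k.+1) /=.
exact: (cvgrX _ (@cvg_at_right0_id R)).
Qed.

Lemma cvg_mul_rprime0 : (x * v x) @[x --> 0^'+] --> (0 : R).
Proof.
apply: (@cvg0_le _ _ _ _ _ (fun x => (Q * r 1) * x)); last first.
  rewrite -[X in _ --> X](mulr0 (Q * r 1)); apply: cvgM; first exact: cvg_cst.
  exact: cvg_at_right0_id.
apply: filterS (@near_at_right01 R) => x /itv01_oo_oc x01; have [x0 x1] := andP x01.
have /andP[q0 q1] := rprime_div_r_le x01; have rx0 := r_gt0 w_gt0 x01.
rewrite ger0_norm; last by rewrite mulr_ge0// ltW// v_gt0.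
rewrite mulrC ler_wpM2r ?(ltW x0)//.
apply: (@le_trans _ _ (Q * r x)); first by rewrite -ler_pdivrMr.
by rewrite ler_wpM2l// (r_le rC2 v_gt0).
Qed.

(** In [ln (r x) - ln x] the first term converges, as [r 0 > 0], and the second is beaten by the
    power of [x]. *)
Lemma cvg_ln_hoop0 : (x ^+ n * ln (r x / x)) @[x --> 0^'+] --> (0 : R).
Proof.
have c1 : (x ^+ n * ln (r x) - x ^+ n * ln x) @[x --> 0^'+] --> (0 : R).
  rewrite -[X in _ --> X]subr0 -[X in X - 0](mul0r (ln (r 0))).
  apply: cvgB.
    apply: cvgM; first exact: cvg_exprn0.
    exact: (continuous_cvg _ (continuous_ln r0_gt0) r_cvg0).
  apply: cvg_at_right0_exprM_ln; last exact: cvg_at_right0_id.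
  exact: nbhs_right_gt.
apply: (cvg_trans _ c1); apply: near_eq_cvg.
apply: filterS (@near_at_right01 R) => x /itv01_oo_oc x01; have [x0 x1] := andP x01.
by rewrite ln_div ?posrE ?(r_gt0 w_gt0)// mulrBr.
Qed.

(** The Cauchy stress is [kappa * (x * v x / r x) ^+ m.+1] plus h' at the determinant. Solved for
    h', this leaves a convergent term, a logarithm and a term vanishing at 0. *)
Lemma derive1h_detE (x : R) : 0 < x <= 1 ->
  derive1 h (d x) =
  S x - kappa * m.+1%:R * ln (r x / x) - kappa * (x * v x / r x) ^+ m.+1.
Proof.
move=> x01; have [x0 x1] := andP x01; have rx0 := r_gt0 w_gt0 x01.
rewrite /log_corrected_stress addrK /cauchy_stress dPhi_r0E//; last first.
  exact: det_gradient_gt0.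
rewrite /= !expr_div_n exprMn; field.
by rewrite !expf_neq0// gt_eqF.
Qed.

Lemma cvg_derive1h_det0 : (x ^+ n * derive1 h (d x)) @[x --> 0^'+] --> (0 : R).
Proof.
have c : (x ^+ n * S x - kappa * m.+1%:R * (x ^+ n * ln (r x / x))
    - kappa * (x ^+ n * (x * v x / r x) ^+ m.+1)) @[x --> 0^'+] --> (0 : R).
  rewrite [X in _ --> X](_ : _ = 0 * lim (S x @[x --> 0^'+])
    - kappa * m.+1%:R * 0 - kappa * (0 * (0 / r 0) ^+ m.+1)); last by ring.
  apply: cvgB; first apply: cvgB.
  - by apply: cvgM; [exact: cvg_exprn0|exact: is_cvg_log_corrected_stress].
  - by apply: cvgM; [exact: cvg_cst|exact: cvg_ln_hoop0].
  - apply: cvgM; first exact: cvg_cst.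
    apply: cvgM; first exact: cvg_exprn0.
    apply: (cvgrX _); apply: cvgM; first exact: cvg_mul_rprime0.
    by apply: cvgV => //; rewrite gt_eqF.
apply: (cvg_trans _ c); apply: near_eq_cvg.
apply: filterS (@near_at_right01 R) => x /itv01_oo_oc x01.
by rewrite derive1h_detE//; ring.
Qed.

(** The tangent at [d x], evaluated at 1, bounds [h (d x)] by [h 1] plus [1 + M] times the size of
    h', and the latter is already controlled. *)
Lemma cvg_h_det0 : (x ^+ n * h (d x)) @[x --> 0^'+] --> (0 : R).
Proof.
apply: (@cvg0_le _ _ _ _ _
    (fun x => h 1 * x ^+ n + (1 + M) * `|x ^+ n * derive1 h (d x)|)); last first.
  rewrite [X in _ --> X](_ : _ = h 1 * 0 + (1 + M) * 0); last by ring.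
  apply: cvgD; first by apply: cvgM; [exact: cvg_cst|exact: cvg_exprn0].
  apply: cvgM; first exact: cvg_cst.
  by apply/norm_cvg0P; exact: cvg_derive1h_det0.
apply: filterS (@near_at_right01 R) => x /itv01_oo_oc x01; have [x0 x1] := andP x01.
have d0 : 0 < d x by exact: det_gradient_gt0.
have X0 : 0 <= x ^+ n by rewrite exprn_ge0// ltW.
rewrite normrM ger0_norm// ger0_norm ?(vol_ge0 hh)// normrM (ger0_norm X0).
rewrite [leRHS](_ : _ = x ^+ n * (h 1 + `|derive1 h (d x)| * (1 + M))); last by ring.
rewrite ler_wpM2l//.
have := volumetric_energy_tangent hh d0 (@ltr01 R).
have : - (derive1 h (d x) * (1 - d x)) <= `|derive1 h (d x)| * (1 + M).
  apply: le_trans (ler_norm _) _; rewrite normrN normrM ler_wpM2l//.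
  apply: le_trans (ler_normB _ _) _; rewrite normr1 lerD2l ger0_norm ?(ltW d0)//.
  exact: dM.
by lra.
Qed.

(** The logarithms cancel, and the stress in [S] cancels the [r] part of [r - x * v]. Of the four
    terms left, only the hoop energy [r e ^+ n] has a nonzero limit. *)
Lemma cvg_energy_primitive0 :
  (energy_primitive m kappa h r e + kappa * m.+1%:R / n%:R * r e ^+ n * ln (r e / e)
   - S e * (r e ^+ n / n%:R)) @[e --> 0^'+] -->
  (kappa * m.+1%:R / n%:R ^+ 2 * r 0 ^+ n).
Proof.
have n0 : n%:R != 0 :> R by rewrite pnatr_eq0.
have c : (n%:R^-1 * ((kappa / n%:R - kappa) * (e * v e) ^+ n
    + kappa * m.+1%:R / n%:R * r e ^+ n
    + e ^+ n * h (d e) - d e * (e ^+ n * derive1 h (d e))))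
    @[e --> 0^'+] --> kappa * m.+1%:R / n%:R ^+ 2 * r 0 ^+ n.
  have -> : kappa * m.+1%:R / n%:R ^+ 2 * r 0 ^+ n =
     n%:R^-1 * ((kappa / n%:R - kappa) * 0 ^+ n
       + kappa * m.+1%:R / n%:R * r 0 ^+ n + 0 - 0) :> R.
    by rewrite expr0n /=; move: n0; rewrite -!natr1 => n0; field.
  apply: cvgM; first exact: cvg_cst.
  apply: cvgB; first apply: cvgD; first apply: cvgD.
  - by apply: cvgM; [exact: cvg_cst|exact: (cvgrX _ cvg_mul_rprime0)].
  - by apply: cvgM; [exact: cvg_cst|exact: (cvgrX _ r_cvg0)].
  - exact: cvg_h_det0.
  - apply: (cvg0M_bounded (M := M)); last exact: cvg_derive1h_det0.
    apply: filterS (@near_at_right01 R) => x /itv01_oo_oc x01.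
    by rewrite gtr0_norm ?dM//; exact: det_gradient_gt0.
apply: (cvg_trans _ c); apply: near_eq_cvg.
apply: filterS (@near_at_right01 R) => x /itv01_oo_oc x01; have [x0 x1] := andP x01.
have d0 : 0 < d x by exact: det_gradient_gt0.
have rx0 := r_gt0 w_gt0 x01.
rewrite /energy_primitive /log_corrected_stress /cauchy_stress Phi_rE dPhi_r0E//=.
move: (derive1 h (d x)) (h (d x)) (ln _) => h1 h0 l.
rewrite /det_gradient /= !expr_div_n !exprMn !exprS.
have X0 : x ^+ m != 0 by rewrite expf_neq0// gt_eqF.
have R0 : r x ^+ m != 0 by rewrite expf_neq0// gt_eqF.
move: n0 X0 R0; rewrite -!natr1; move: (v x ^+ m) (x ^+ m) (r x ^+ m) => V X W.
by move=> n0 X0 R0; field; rewrite n0 X0 R0 !gt_eqF.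
Qed.

Lemma modified_energy_cavitating :
  [/\ (truncated_modified_energy n kappa h r e @[e --> 0^'+]) -->
      (n%:R^-1 * (Phi_r n kappa h r 1 - v 1 * Phi1 1
                     + r 1 ^+ n * cauchy_stress n kappa h r 1)
          - kappa * n.-1%:R / n%:R ^+ 2 * r 0 ^+ n
          - lim ((S e * (r e ^+ n / n%:R)) @[e --> 0^'+]))%:E &
      cvg ((S e * (r e ^+ n / n%:R)) @[e --> 0^'+])].
Proof.
have cS : cvg ((S e * (r e ^+ n / n%:R)) @[e --> 0^'+]).
  apply: is_cvgM; first exact: is_cvg_log_corrected_stress.
  apply: is_cvgM; last exact: is_cvg_cst.
  by apply/cvg_ex; exists (r 0 ^+ n); exact: (cvgrX _ r_cvg0).
split=> //.
have r1 : r 1 != 0 by rewrite gt_eqF// (r_gt0 w_gt0)// ltr01 lexx.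
have E1 : energy_primitive m kappa h r 1 = n%:R^-1 * (Phi_r n kappa h r 1 - v 1 * Phi1 1
                     + r 1 ^+ n * cauchy_stress n kappa h r 1).
  rewrite /energy_primitive /cauchy_stress !expr1n !mul1r; congr (_ * _).
  rewrite /= exprVn (exprSr _ m.+1).
  by field; rewrite expf_neq0.
rewrite -E1.
(* The stress term is added and subtracted, so that each bracket converges separately. *)
have c : (energy_primitive m kappa h r 1 - (energy_primitive m kappa h r e
      + kappa * m.+1%:R / n%:R * r e ^+ n * ln (r e / e) - S e * (r e ^+ n / n%:R))
      - S e * (r e ^+ n / n%:R)) @[e --> 0^'+] -->
    (energy_primitive m kappa h r 1 - kappa * n.-1%:R / n%:R ^+ 2 * r 0 ^+ n
          - lim ((S e * (r e ^+ n / n%:R)) @[e --> 0^'+])).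
  apply: cvgB => //; apply: cvgB; first exact: cvg_cst.
  exact: cvg_energy_primitive0.
(* Finiteness near 0 and equality of the real values remain; the closed form of the integral settles
   both. *)
apply: cvg_EFin; last apply: (cvg_trans _ c); last apply: near_eq_cvg.
all: apply: filterS (@near_at_right01 R) => x x01.
all: rewrite /= /truncated_modified_energy (integral_energy_density hh rC2 v_gt0 w_gt0)//.
by rewrite -EFinB /=; ring.
Qed.

End cavitating.

(** * The case r(0) = 0 *)

Section noncavitating.
Variables (R : realType) (m : nat) (kappa : R) (h r : R -> R).

Local Notation n := m.+2.
Local Notation v := (rprime r).
Local Notation A := (`]0, 1]%classic : set R).
Local Notation f := (fun x => x ^+ n.-1 * Phi_r n kappa h r x).
Local Notation mu := (@lebesgue_measure R).

Hypothesis kappa0 : 0 < kappa.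
Hypothesis hh : volumetric_energy h.
Hypothesis rC2 : C2_on A r.
Hypothesis v_gt0 : forall x : R, 0 < x <= 1 -> 0 < v x.
Hypothesis w_gt0 : forall x : R, 0 < x <= 1 -> 0 < r x / x.
Hypothesis hsol : radial_equilibrium n kappa h r.
Hypothesis r_cvg0 : r x @[x --> 0^'+] --> (0 : R).

Let c : R := kappa * m.+1%:R / n%:R.

Let c_ge0 : 0 <= c. Proof. by rewrite divr_ge0// mulr_ge0// ltW. Qed.

(** The subtracted term integrates over [[e, 1]] to [- c * r e ^+ n * ln e], the part of the
    logarithmic correction that comes from [ln e]. *)
Definition reduced_density (e x : R) : R := f x - c * r e ^+ n / x.

Lemma within_continuous_reduced_density (e : R) :
  {within A, continuous (reduced_density e)}.
Proof.
apply/within_continuousP => x x01; apply: cvgB.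
  have H := @within_continuous_energy_density R m kappa h r hh rC2 v_gt0 w_gt0.
  exact: ((within_continuousP _).1 H x x01).
apply: cvgM; first exact: cvg_cst.
apply: cvgV; last exact: cvg_within_id.
by case/andP: x01 => /lt0r_neq0.
Qed.

(** The hoop part of the density at [x] is exactly [c * r x ^+ n / x], which dominates the
    subtracted term because [r e <= r x]; the radial and volumetric parts are nonnegative. *)
Lemma reduced_density_ge0 (e x : R) : 0 < e -> e <= x -> x <= 1 ->
  0 <= reduced_density e x.
Proof.
move=> e0 ex x1; have x0 : 0 < x by exact: lt_le_trans ex.
have x01 : 0 < x <= 1 by rewrite x0.
have e01 : 0 < e <= 1 by rewrite e0 (le_trans ex).
have h0 : 0 <= h (det_gradient n r x).
  by apply: (vol_ge0 hh); exact: det_gradient_gt0.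
rewrite /reduced_density subr_ge0 Phi_rE.
apply: (@le_trans _ _ (c * r x ^+ n / x)).
  rewrite ler_wpM2r ?invr_ge0 ?(ltW x0)// ler_wpM2l//.
  have re := r_gt0 w_gt0 e01; have rx := r_gt0 w_gt0 x01.
  by rewrite lerXn2r ?nnegrE ?(ltW re) ?(ltW rx)// (r_le rC2 v_gt0).
have -> : c * r x ^+ n / x = x ^+ n.-1 * (kappa / n%:R * (m.+1%:R * (r x / x) ^+ n)).
  rewrite /c expr_div_n (exprS x m.+1) /=.
  have n0 : n%:R != 0 :> R by rewrite pnatr_eq0.
  move: n0; rewrite -!natr1 => n0; field.
  by rewrite n0 expf_neq0 ?gt_eqF.
rewrite ler_wpM2l ?exprn_ge0 ?(ltW x0)//.
have : 0 <= kappa / n%:R * v x ^+ n.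
  by rewrite mulr_ge0 ?exprn_ge0 ?divr_ge0// ltW// v_gt0.
by move=> vn0; rewrite mulrDr -addrA addrCA lerDl addr_ge0.
Qed.

Lemma reduced_density_le (a b x : R) : 0 < a -> a <= b -> b <= 1 -> 0 < x ->
  reduced_density b x <= reduced_density a x.
Proof.
move=> a0 ab b1 x0; rewrite /reduced_density lerD2l lerN2.
rewrite ler_wpM2r ?invr_ge0 ?(ltW x0)// ler_wpM2l//.
have b01 : 0 < b <= 1 by rewrite (lt_le_trans a0 ab).
have a01 : 0 < a <= 1 by rewrite a0 (le_trans ab).
have ra := r_gt0 w_gt0 a01; have rb := r_gt0 w_gt0 b01.
by rewrite lerXn2r ?nnegrE ?(ltW ra) ?(ltW rb)// (r_le rC2 v_gt0).
Qed.

Lemma truncated_modified_energyE (e : R) : 0 < e < 1 ->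
  truncated_modified_energy n kappa h r e =
  (\int[mu]_(x in `[e, 1%R]) (reduced_density e x)%:E
   - (c * (r e ^+ n * ln (r e)))%:E)%E.
Proof.
move=> e01; have [e0 e1] := andP e01.
have re := r_gt0 w_gt0 (itv01_oo_oc e01).
pose F x := energy_primitive m kappa h r x - c * r e ^+ n * ln x.
have -> : (\int[mu]_(x in `[e, 1%R]) (reduced_density e x)%:E = (F 1 - F e)%:E)%E.
  apply: (FTC2_oc e01).
  - apply/within_continuousP => x x01; apply: cvgB.
      have H := @within_continuous_energy_primitive R m kappa h r hh rC2 v_gt0 w_gt0.
      exact: ((within_continuousP _).1 H x x01).
    apply: cvgM; first exact: cvg_cst.
    apply: (@continuous_cvg _ _ _ _ _ id (@ln R)); last exact: cvg_within_id.
    by apply: continuous_ln; case/andP: x01.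
  - exact: within_continuous_reduced_density.
  - move=> x x01; apply: is_derive1B.
      exact: (is_derive_energy_primitive hh rC2 v_gt0 w_gt0 hsol).
    by apply: is_derive1Z; apply: is_derive1_ln; case/andP: x01.
rewrite /truncated_modified_energy (integral_energy_density hh rC2 v_gt0 w_gt0)//.
rewrite -!EFinB /F ln1 ln_div ?posrE//= -/c; congr (_%:E).
by ring.
Qed.

Local Notation J :=
  (fun e : R => (\int[mu]_(x in `[e, 1%R]) (reduced_density e x)%:E)%E).
(** Extension by zero turns integrals over varying intervals into integrals of a monotone family on
    the whole line. *)
Definition restricted_density (e : R) : R -> \bar R :=
  (EFin \o reduced_density e) \_ `[e, 1].

Local Notation g := restricted_density.

Lemma measurable_fun_reduced_density (e : R) : 0 < e ->
  measurable_fun [set: R] (g e).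
Proof.
move=> e0; apply/(measurable_restrictT _ _).1 => //.
apply/measurable_EFinP; apply: subspace_continuous_measurable_fun => //.
have sub : `[e, 1] `<=` A by apply: subset_itvr; rewrite bnd_simp.
exact: (continuous_subspaceW sub (@within_continuous_reduced_density e)).
Qed.

Lemma restrict_reduced_density_ge0 (e x : R) : 0 < e -> (0 <= g e x)%E.
Proof.
move=> e0; rewrite /restricted_density patchE; case: ifPn => //.
rewrite inE /= in_itv/= => /andP[ex x1].
by rewrite lee_fin reduced_density_ge0.
Qed.

Lemma restrict_reduced_density_le (a b x : R) : 0 < a -> a <= b -> b <= 1 ->
  (g b x <= g a x)%E.
Proof.
move=> a0 ab b1; rewrite {1}/restricted_density patchE; case: ifPn => [|_].
  rewrite inE /= in_itv/= => /andP[bx x1].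
  rewrite /restricted_density patchE mem_set /= ?in_itv/= ?x1 ?(le_trans ab)//.
  by rewrite lee_fin reduced_density_le// (lt_le_trans a0)// (le_trans ab).
exact: restrict_reduced_density_ge0.
Qed.

Lemma J_le (a b : R) : 0 < a -> a <= b -> b <= 1 -> (J b <= J a)%E.
Proof.
move=> a0 ab b1; rewrite [leLHS]integral_mkcond [leRHS]integral_mkcond.
apply: ge0_le_integral => //.
- by move=> x _; apply: restrict_reduced_density_ge0; exact: lt_le_trans ab.
- by apply: measurable_fun_reduced_density; exact: lt_le_trans ab.
- exact: measurable_fun_reduced_density.
- by move=> x _; exact: restrict_reduced_density_le.
Qed.

Let u (k : nat) : R := k.+1%:R^-1.

Let u_gt0 k : 0 < u k. Proof. by rewrite invr_gt0. Qed.
Let u_le1 k : u k <= 1. Proof. by rewrite invf_le1// ler1n. Qed.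

Let u_cvg : u k @[k --> \oo] --> 0^'+.
Proof.
move=> P P0.
have P0' : \forall x \near (0 : R), 0 < x -> P x by exact: P0.
have H : \forall k \near \oo, 0 < u k -> P (u k) by exact: (@cvg_harmonic R _ P0').
change (\forall k \near \oo, P (u k)).
by apply: filterS H => k; apply.
Qed.

(** Monotone convergence works along sequences, hence the passage to [u k], which decreases to 0
    within (0, 1]. *)
Lemma cvg_J_energy : J (u k) @[k --> \oo] --> energy n kappa h r.
Proof.
rewrite /energy integral_mkcond.
under eq_fun do rewrite integral_mkcond.
have nd x : nondecreasing_seq (fun k => g (u k) x).
  move=> i j ij; apply: restrict_reduced_density_le => //.
  by rewrite lef_pV2 ?posrE// ler_nat.
rewrite (_ : (fun x => (f x)%:E) \_ _ = (fun x => limn (fun k => g (u k) x))).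
  apply: cvg_monotone_convergence => //.
  - by move=> k; exact: measurable_fun_reduced_density.
  - by move=> k x _; exact: restrict_reduced_density_ge0.
apply/funext => x; apply/esym/cvg_lim => //; rewrite patchE.
case: ifPn => [|xA].
  rewrite inE /= in_itv/= => /andP[x0 x1].
  (* For fixed [x] the restriction to [[u k, 1]] is eventually invisible, and the subtracted term
     vanishes because [r (u k)] tends to 0. *)
  have ux : \forall k \near \oo, u k <= x.
    have := nbhs_right_ltW x0; exact: u_cvg.
  have lim : (f x - c * r (u k) ^+ n / x) @[k --> \oo] --> f x.
    rewrite [X in _ --> X](_ : _ = f x - c * 0 ^+ n / x); last first.
      by rewrite expr0n /= mulr0 mul0r subr0.
    apply: cvgB; first exact: cvg_cst.
    apply: cvgM; last exact: cvg_cst.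
    apply: cvgM; first exact: cvg_cst.
    exact: (cvgrX _ (cvg_comp _ _ u_cvg r_cvg0)).
  have gE k : u k <= x -> g (u k) x = (f x - c * r (u k) ^+ n / x)%:E.
    by move=> ukx; rewrite /restricted_density patchE mem_set//= in_itv/= ukx.
  have limE : (f x - c * r (u k) ^+ n / x)%:E @[k --> \oo] --> (f x)%:E.
    by apply: cvg_EFin => //; exact: nearW.
  apply: (cvg_trans _ limE); apply: near_eq_cvg.
  by apply: filterS ux => k /gE ->.
rewrite (_ : (fun k => g (u k) x) = cst 0%E); first exact: cvg_cst.
apply/funext => k; rewrite /restricted_density patchE memNset//.
rewrite /= in_itv/= => /andP[ux x1]; move/negP: xA; apply.
by rewrite inE /= in_itv/= x1 (lt_le_trans _ ux).
Qed.

Lemma modified_energy_noncavitating :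
  truncated_modified_energy n kappa h r e @[e --> 0^'+] --> energy n kappa h r.
Proof.
have cJ : J e @[e --> 0^'+] --> energy n kappa h r.
  (* Monotonicity in [e] guarantees a limit along the full filter; the sequence [u] then identifies
     it. *)
  have cl : J e @[e --> 0^'+] --> ereal_sup (J @` `]0, 1[).
    apply: (@nonincreasing_at_right_cvge _ _ _ (BLeft 1)).
      by rewrite bnd_simp ltr01.
    move=> x y; rewrite !in_itv/= => /andP[x0 _] /andP[_ y1] xy.
    by apply: J_le => //; exact: ltW.
  have := cvg_unique _ cvg_J_energy (cvg_comp _ _ u_cvg cl).
  by move=> ->.
have cr : (c * (r e ^+ n * ln (r e))) @[e --> 0^'+] --> (0 : R).
  rewrite -[X in _ --> X](mulr0 c); apply: cvgM; first exact: cvg_cst.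
  apply: cvg_at_right0_exprM_ln => //.
  by apply: filterS (@near_at_right01 R) => x /itv01_oo_oc /(r_gt0 w_gt0).
(* The subtracted term is finite, so the extended-real difference is defined even when the energy is
   infinite. *)
have cE : ((J e - (c * (r e ^+ n * ln (r e)))%:E)%E) @[e --> 0^'+]
    --> energy n kappa h r.
  rewrite -[X in _ --> X]sube0; apply: cvgeB => //.
    by rewrite fin_num_adde_defl.
  by apply: cvg_EFin => //; near=> x.
apply: (cvg_trans _ cE); apply: near_eq_cvg.
by apply: filterS (@near_at_right01 R) => x /truncated_modified_energyE ->.
Unshelve. all: by end_near. Qed.

End noncavitating.

Theorem proposition2p6 (R : realType) (n : nat) (hn : n = 2%N \/ n = 3%N)
    (kappa : R) (hkappa : 0 < kappa)
    (h : R -> R) (hh : volumetric_energy h)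
    (K gamma0 : R) (hK : 0 < K) (hgamma0 : 0 < gamma0)
    (hgrowth : forall c d : R, 0 < d -> 0 < c -> `|c - 1| <= gamma0 ->
       `|d * derive1 h (c * d)| <= K * (h d + 1))
    (r : R -> R)
    (hrC2 : C2_on `]0, 1] r)
    (hrC : {within `[0, 1], continuous r})
    (hr' : forall x : R, 0 < x <= 1 -> 0 < rprime r x)
    (hr : forall x : R, 0 < x <= 1 -> 0 < r x / x)
    (hsol : radial_equilibrium n kappa h r)
    (lambda : R) (hlambda : lambda = r 1) :
  (0 < r 0 -> [bounded det_gradient n r x | x in `]0, 1]] ->
     let stress_term (e : R) :=
       (cauchy_stress n kappa h r e + kappa * n.-1%:R * ln (r e / e))
         * (r e ^+ n / n%:R) in
     [/\ cvg (truncated_modified_energy n kappa h r e @[e --> 0^'+]),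
         cvg (stress_term e @[e --> 0^'+]) &
         modified_energy n kappa h r =
         (n%:R^-1 * (Phi_r n kappa h r 1
                     - rprime r 1 * dPhi_r n kappa h r 0 1
                     + lambda ^+ n * cauchy_stress n kappa h r 1)
          - kappa * n.-1%:R / n%:R ^+ 2 * r 0 ^+ n
          - lim (stress_term e @[e --> 0^'+]))%:E])
  /\
  (r 0 = 0 ->
     cvg (truncated_modified_energy n kappa h r e @[e --> 0^'+]) /\
     modified_energy n kappa h r = energy n kappa h r).
Proof.
(* In both dimensions [n.-1] and [n.-2] are then the true differences. *)
have [m nE] : exists m, n = m.+2 by case: hn => ->; [exists 0%N|exists 1%N].
subst n lambda.
(* Continuity on the closed interval enters as the one-sided limit at 0. *)
have rcvg : r x @[x --> 0^'+] --> r 0.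
  by have [_ + _] := (continuous_within_itvP r (@ltr01 R)).1 hrC.
split=> [r0 bd stress_term|r0].
  have [M dM] : exists M, forall x : R, 0 < x <= 1 -> det_gradient m.+2 r x <= M.
    have [M _ HM] := pinfty_ex_gt0 bd.
    exists M => x x01; apply: le_trans (ler_norm _) (HM x _).
    by rewrite /= in_itv.
  have [cT cS] := modified_energy_cavitating hkappa hh hrC2 hr' hr hsol rcvg r0 dM.
  by split; [exact: cvgP cT|exact: cS|exact: cvg_lim cT].
rewrite r0 in rcvg.
have cT := modified_energy_noncavitating hkappa hh hrC2 hr' hr hsol rcvg.
by split; [exact: cvgP cT|exact: cvg_lim cT].
Qed.
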